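(* Let $\pi$ be a probability distribution on the state space $S$. Then for any $\lambda>0$ and $\epsilon>0$ there exists $t(\lambda,\epsilon)>0$ such that, for each $\epsilon>0$, $\lim_{\lambda\to\infty}t(\lambda,\epsilon)=0$ and, when $\lambda$ is sufficiently large (depending on $\epsilon$), $$d_{TV}\bigl(P^\lambda_\pi(X_{t(\lambda,\epsilon)}\in\cdot),\,P^\lambda_\pi(X_{\tau_B}\in\cdot)\bigr)\le\epsilon .$$
   Context: Setting. $S=\{1,\dots,|S|\}$ is a finite set. For each $\lambda>0$, $Q(\lambda)=(q_{ij}(\lambda))$ is an irreducible transition rate matrix on $S$ (nonnegative off-diagonal entries, rows summing to $0$), and $X=\{X_t:t\ge0\}$ is the continuous-time Markov chain on $S$ with transition rate matrix $Q(\lambda)$; $P^\lambda_\pi$ denotes its law with initial distribution $\pi$. For all $i\ne j$, $\lim_{\lambda\to\infty}q_{ij}(\lambda)$ exists in $[0,\infty]$. Put $q_i(\lambda)=-q_{ii}(\lambda)=\sum_{j\ne i}q_{ij}(\lambda)$ and $q_i=\lim_{\lambda\to\infty}q_i(\lambda)\in[0,\infty]$. The fast state space is $A=\{i:q_i=\infty\}$ and the slow state space is $B=\{i:q_i<\infty\}$; it is assumed that $B\neq\emptyset$ and $q_i>0$ for all $i\in B$. Jump chain. $\Omega(\lambda)=(\omega_{ij}(\lambda))$ with $\omega_{ij}(\lambda)=q_{ij}(\lambda)/q_i(\lambda)$ for $i\neq j$ and $\omega_{ii}(\lambda)=0$. It is assumed that $\lim_{\lambda\to\infty}\omega_{ij}(\lambda)$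 exists for all $i\ne j$; $\Omega=\lim_{\lambda\to\infty}\Omega(\lambda)$ is a stochastic matrix. Let $\eta=\{\eta_n\}_{n\ge0}$ be the discrete-time Markov chain with transition matrix $\Omega$ and $T_B=\inf\{n\ge0:\eta_n\in B\}$; it is assumed that $P_i(T_B<\infty)=1$ for all $i\in A$. First-passage time: $\tau_B=\inf\{t\ge0:X_t\in B\}$ is the first-passage time of $B$ for $X$. Total variation distance: $d_{TV}(\mu,\nu)=\frac12\sum_{i\in S}|\mu_i-\nu_i|$ for probability measures $\mu,\nu$ on $S$. *)

(* Defs.v *)
From HB Require Import structures.
From mathcomp Require Import all_boot all_order all_algebra.
From mathcomp Require Import all_classical all_reals all_analysis.

Set Implicit Arguments.
Unset Strict Implicit.
Unset Printing Implicit Defensive.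

Import Order.TTheory GRing.Theory Num.Theory.
Import numFieldNormedType.Exports.

Local Open Scope classical_set_scope.
Local Open Scope ring_scope.

(* The state space {1, ..., |S|} is 'I_n with n = |S|.  A family
   Q : R -> 'M[R]_n stands for lambda |-> Q(lambda); only the values at
   lambda > 0 are meaningful. *)

Definition is_distribution (R : realType) (n : nat) (mu : 'I_n -> R) : Prop :=
  (forall i, 0 <= mu i) /\ \sum_i mu i = 1.

Definition point_mass (R : realType) (n : nat) (i : 'I_n) : 'I_n -> R :=
  fun j => (j == i)%:R.

Definition total_variation_distance (R : realType) (n : nat)
    (mu nu : 'I_n -> R) : R :=
  2^-1 * \sum_i `|mu i - nu i|.

Definition is_rate_matrix (R : realType) (n : nat) (Q : 'M[R]_n) : Prop :=
  (forall i j, i != j -> 0 <= Q i j) /\ (forall i, \sum_j Q i j = 0).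

(* The diagonal entries of a rate matrix are nonpositive, so the edges of the
   relation below are exactly the possible jumps. *)
Definition irreducible_rates (R : realType) (n : nat) (Q : 'M[R]_n) : Prop :=
  forall i j, connect (fun a b => 0 < Q a b) i j.

Definition exit_rate (R : realType) (n : nat) (Q : 'M[R]_n) (i : 'I_n) : R :=
  - Q i i.

Definition limit_exit_rate (R : realType) (n : nat) (Q : R -> 'M[R]_n)
    (i : 'I_n) : \bar R :=
  lim ((exit_rate (Q l) i)%:E @[l --> +oo]).

Definition fast_states (R : realType) (n : nat) (Q : R -> 'M[R]_n) :
    set 'I_n :=
  [set i | limit_exit_rate Q i = +oo%E].

Definition slow_states (R : realType) (n : nat) (Q : R -> 'M[R]_n) :
    set 'I_n :=
  [set i | (limit_exit_rate Q i < +oo)%E].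

Definition jump_matrix (R : realType) (n : nat) (Q : 'M[R]_n) : 'M[R]_n :=
  \matrix_(i, j) (if i == j then 0 else Q i j / exit_rate Q i).

Definition limit_jump_matrix (R : realType) (n : nat) (Q : R -> 'M[R]_n) :
    'M[R]_n :=
  \matrix_(i, j) lim (jump_matrix (Q l) i j @[l --> +oo]).

(* The transition function exp(tQ), with the exponential series summed
   entrywise. *)
Definition transition_function (R : realType) (n : nat) (Q : 'M[R]_n) (t : R) :
    'M[R]_n :=
  \matrix_(i, j)
    limn (series (fun k : nat => ((t *: Q) ^+ k) i j / (k`!)%:R)).

Definition is_dtmc (R : realType) (n : nat) (d : measure_display)
    (T : measurableType d) (P : probability T R) (Y : nat -> T -> 'I_n)
    (mu : 'I_n -> R) (W : 'M[R]_n) : Prop :=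
  (forall m i, measurable [set w | Y m w = i]) /\
  (forall (k : nat) (s : nat -> 'I_n),
     P [set w | forall m, (m <= k)%N -> Y m w = s m] =
     (mu (s 0%N) * \prod_(m < k) W (s m) (s m.+1))%:E).

(* A continuous-time chain with initial distribution mu and rate matrix Q:
   right-continuous paths (for the discrete topology on the state space) and
   Markovian finite-dimensional distributions given by exp(tQ).  The process is
   indexed by R, but only the times t >= 0 are constrained or used. *)
Record is_ctmc (R : realType) (n : nat) (d : measure_display)
    (T : measurableType d) (P : probability T R) (X : R -> T -> 'I_n)
    (mu : 'I_n -> R) (Q : 'M[R]_n) : Prop := IsCTMC {
  ctmc_measurable : forall t i, 0 <= t -> measurable [set w | X t w = i] ;
  ctmc_right_continuous :
    forall w t, 0 <= t -> \forall u \near t^'+, X u w = X t w ;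
  ctmc_fdd : forall (k : nat) (t : nat -> R) (s : nat -> 'I_n),
    t 0%N = 0 -> (forall m, t m <= t m.+1) ->
    P [set w | forall m, (m <= k)%N -> X (t m) w = s m] =
    (mu (s 0%N) *
     \prod_(m < k) transition_function Q (t m.+1 - t m) (s m) (s m.+1))%:E
}.

(* Both hitting times are infima in the extended reals, so that they are +oo
   when the set is never hit. *)
Definition discrete_hitting_time (R : realType) (n : nat) (T : Type)
    (Y : nat -> T -> 'I_n) (B : set 'I_n) (w : T) : \bar R :=
  ereal_inf [set (m%:R)%:E | m in [set m : nat | B (Y m w)]].

Definition first_passage_time (R : realType) (n : nat) (T : Type)
    (X : R -> T -> 'I_n) (B : set 'I_n) (w : T) : \bar R :=
  ereal_inf [set t%:E | t in [set t : R | 0 <= t /\ B (X t w)]].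

Definition law_at (R : realType) (n : nat) (d : measure_display)
    (T : measurableType d) (P : probability T R) (X : R -> T -> 'I_n) (t : R)
    (i : 'I_n) : R :=
  fine (P [set w | X t w = i]).

(* X at the first-passage time is only defined where that time is finite. *)
Definition law_at_first_passage (R : realType) (n : nat) (d : measure_display)
    (T : measurableType d) (P : probability T R) (X : R -> T -> 'I_n)
    (B : set 'I_n) (i : 'I_n) : R :=
  fine (P [set w | (first_passage_time X B w < +oo)%E /\
                   X (fine (first_passage_time X B w)) w = i]).

(* Main.v *)
Require Import Defs.
From HB Require Import structures.
From mathcomp Require Import all_boot all_order all_algebra.
From mathcomp Require Import all_classical all_reals all_analysis.
From mathcomp Require Import ring lra.

Import Order.TTheory GRing.Theory Num.Theory.
Import numFieldNormedType.Exports.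

Local Open Scope classical_set_scope.
Local Open Scope ring_scope.

(* Since the limiting jump chain almost surely reaches the slow set B, summing
   its survival probabilities up to a large step gives a bounded g >= 0 that
   vanishes on B and satisfies Omega g <= g - 1/2 off B.  For large lambda, g is
   still a Lyapunov function: Q(lambda) g <= - q_i(lambda)/4 at every fast i, so
   P(tau_B > t) = O(1 / (t min q_i(lambda))), the minimum being over the fast i.
   The exit rates on B stay bounded by some K, so the chain leaves the state
   X_{tau_B} before time t with probability O(K t).  Taking t^2 of the order of
   max 1/q_i(lambda) makes t and both errors vanish.

   The strong Markov property is avoided by discretizing: the skeleton of X on
   the grid t/(N+1) is a discrete-time chain with kernel I + hQ + O(h^2), and
   right-continuity alone shows that for large N the state at the first grid
   time in B is X_{tau_B}. *)

(** * Probabilities as real numbers *)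

Lemma fine_probability_le {R : realType} {d : measure_display}
    {T : measurableType d} (P : probability T R) (A B : set T) :
  measurable A -> measurable B -> A `<=` B -> fine (P A) <= fine (P B).
Proof.
move=> mA mB AB; apply: fine_le; rewrite ?fin_num_measure//.
by apply: le_measure; rewrite ?inE.
Qed.

Lemma total_probability {R : realType} {d : measure_display}
    {T : measurableType d} (P : probability T R) {I : finType} (Z : T -> I)
    (A : set T) :
  measurable A -> (forall i, measurable [set w | Z w = i]) ->
  fine (P A) = \sum_i fine (P (A `&` [set w | Z w = i])).
Proof.
move=> mA mZ.
have mAZ i : measurable (A `&` [set w | Z w = i]) by exact: measurableI.
have {1}-> : A = \bigcup_(i in [set: I]) (A `&` [set w | Z w = i]).
  apply/seteqP; split=> [w Aw|w [i _ [Aw _]]] //.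
  by exists (Z w).
rewrite measure_fin_bigcup//=; last by move=> i j _ _ [w [[_ /= <-] [_ /= <-]]].
rewrite (fsbig_fwiden (index_enum I)) ?index_enum_uniq//; first last.
- by move=> i [_ /(_ Logic.I)].
- by move=> i _; exact: mem_index_enum.
rewrite -[RHS]/(fine _%:E) -sumEFin; congr fine; apply: eq_bigr => i _.
by rewrite fineK ?fin_num_measure.
Qed.

Lemma fine_probability_setU {R : realType} {d : measure_display}
    {T : measurableType d} (P : probability T R) (A B : set T) :
  measurable A -> measurable B -> fine (P (A `|` B)) <= fine (P A) + fine (P B).
Proof.
move=> mA mB; rewrite -fineD ?fin_num_measure//; apply: fine_le.
- by rewrite fin_num_measure//; exact: measurableU.
- by rewrite fin_numD !fin_num_measure.
- exact: measureU2.
Qed.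

Lemma fine_probability_le1 {R : realType} {d : measure_display}
    {T : measurableType d} (P : probability T R) (A : set T) :
  measurable A -> fine (P A) <= 1.
Proof.
by move=> mA; rewrite -[1]/(fine 1%E); apply: fine_le; rewrite ?fin_num_measure ?probability_le1.
Qed.

(** Membership in the natural filtration at time [k], expressed on trajectories. *)
Definition depends_on_prefix {n : nat} (k : nat) (F : set (nat -> 'I_n)) : Prop :=
  forall s s', (forall m, (m <= k)%N -> s m = s' m) -> F s -> F s'.

(** * Discrete-time chains: Markov property, avoidance and exit bounds *)

Section dtmc.
Context {R : realType} {n : nat} {d : measure_display} {T : measurableType d}.
Context {P : probability T R} {Y : nat -> T -> 'I_n}.
Context {mu : 'I_n -> R} {W : 'M[R]_n}.
Hypothesis chainY : is_dtmc P Y mu W.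

Lemma measurable_path k (s : nat -> 'I_n) :
  measurable [set w | forall m, (m <= k)%N -> Y m w = s m].
Proof.
rewrite (_ : [set w | _] = \bigcap_(m in [set m | (m <= k)%N]) [set w | Y m w = s m]).
  by apply: bigcap_measurable => [|m _]; [exists 0%N | exact: (proj1 chainY)].
by apply/seteqP; split.
Qed.

Let prefix k (w : T) : {ffun 'I_k.+1 -> 'I_n} := [ffun m : 'I_k.+1 => Y m w].

Let path {k} (f : {ffun 'I_k.+1 -> 'I_n}) (m : nat) : 'I_n := f (inord m).

Let prefixE k (f : {ffun 'I_k.+1 -> 'I_n}) :
  [set w | prefix k w = f] = [set w | forall m, (m <= k)%N -> Y m w = path f m].
Proof.
apply/seteqP; split=> w /= => [<- m mk|H]; first by rewrite /path ffunE inordK.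
apply/ffunP => m; rewrite ffunE H ?leq_ord// /path; congr (f _).
by apply: val_inj; rewrite /= inordK.
Qed.

Let measurable_prefix k f : measurable [set w | prefix k w = f].
Proof. by rewrite prefixE; exact: measurable_path. Qed.

Lemma measurable_prefix_event k (F : set (nat -> 'I_n)) :
  depends_on_prefix k F -> measurable [set w | F (Y^~ w)].
Proof.
move=> dF.
rewrite (_ : [set w | _] = \bigcup_(f in [set f | F (path f)]) [set w | prefix k w = f]).
  by apply: fin_bigcup_measurable => [|f _]; [exact: finite_finset|exact: measurable_prefix].
apply/seteqP; split=> [w Fw|w [f Ff]].
  exists (prefix k w) => //=; apply: dF Fw => m mk.
  by rewrite /path ffunE inordK.
by rewrite prefixE /= => H; apply: dF Ff => m mk; rewrite H.
Qed.

Lemma measurable_avoid (B : set 'I_n) k :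
  measurable [set w | forall m, (m <= k)%N -> ~ B (Y m w)].
Proof.
apply: (measurable_prefix_event k [set s | forall m, (m <= k)%N -> ~ B (s m)]).
by move=> s s' ss' As m mk; rewrite -ss'//; exact: As.
Qed.

Lemma measurable_exit (B : set 'I_n) k :
  measurable [set w | exists2 m, (m < k)%N & B (Y m w) /\ Y m.+1 w <> Y m w].
Proof.
apply: (measurable_prefix_event k
  [set s | exists2 m, (m < k)%N & B (s m) /\ s m.+1 <> s m]).
by move=> s s' ss' [m mk [/= H1 H2]]; exists m => //; rewrite -!ss'// ltnW.
Qed.

(** [is_dtmc] prescribes cylinder probabilities only. Splitting over the finitely many prefixes of
    length [k.+1] reduces the claim to cylinders, where one more step contributes the factor
    [W i j]. *)
Lemma dtmc_markov k (F : set (nat -> 'I_n)) i j :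
  depends_on_prefix k F ->
  fine (P [set w | F (Y^~ w) /\ Y k w = i /\ Y k.+1 w = j]) =
  fine (P [set w | F (Y^~ w) /\ Y k w = i]) * W i j.
Proof.
move=> dF.
have mY m a : measurable [set w | Y m w = a] := proj1 chainY m a.
have mF : measurable [set w | F (Y^~ w)] by exact: measurable_prefix_event dF.
have mFi : measurable [set w | F (Y^~ w) /\ Y k w = i].
  by apply: measurableI; [exact: mF | exact: mY].
have mFij : measurable [set w | F (Y^~ w) /\ Y k w = i /\ Y k.+1 w = j].
  by apply: measurableI; [exact: mF | apply: measurableI; exact: mY].
rewrite (total_probability _ (prefix k) _ mFij (measurable_prefix k)).
rewrite (total_probability _ (prefix k) _ mFi (measurable_prefix k)) mulr_suml.
apply: eq_bigr => f _; rewrite prefixE.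
(* A prefix incompatible with [F], or with the state [i] at time [k], contributes zero to both
   sides. *)
have [[Ff fi]|nF] := pselect (F (path f) /\ path f k = i); last first.
  rewrite [X in P X](_ : _ = set0); last first.
    apply/seteqP; split=> // w [[Fw [wi _]] /= wf]; apply: nF; split.
      by apply: dF Fw => m mk; rewrite wf.
    by rewrite -wf.
  rewrite [X in _ = fine (P X) * _](_ : _ = set0); last first.
    apply/seteqP; split=> // w [[Fw wi] /= wf]; apply: nF; split.
      by apply: dF Fw => m mk; rewrite wf.
    by rewrite -wf.
  by rewrite measure0 mul0r.
pose s m := if (m <= k)%N then path f m else j.
rewrite [X in P X](_ : _ = [set w | forall m, (m <= k.+1)%N -> Y m w = s m]); last first.
  apply/seteqP; split=> w /= => [[[Fw [wi wj]] wf] m|H].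
    rewrite /s; case: (leqP m k) => mk mk1; first by rewrite wf.
    by have -> : m = k.+1 by apply/eqP; rewrite eqn_leq mk1.
  have wf m : (m <= k)%N -> Y m w = path f m by move=> mk; rewrite H ?leqW// /s mk.
  split=> //; split; first by apply: dF Ff => m mk; rewrite wf.
  by rewrite wf// H// /s ltnn.
rewrite [X in _ = fine (P X) * _](_ : _ =
  [set w | forall m, (m <= k)%N -> Y m w = path f m]); last first.
  apply/seteqP; split=> w /= => [[]//|wf]; split=> //; split; last by rewrite wf.
  by apply: dF Ff => m mk; rewrite wf.
rewrite (proj2 chainY) (proj2 chainY)/= big_ord_recr/= -mulrA.
rewrite /s leqnn ltnn fi; congr (_ * (_ * _)); apply: eq_bigr => m _.
by rewrite ltnW ?ltn_ord.
Qed.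

Section avoid.
Variable B : set 'I_n.

Let avoid k : set (nat -> 'I_n) := [set s | forall m, (m <= k)%N -> ~ B (s m)].

Let avoid_prefix k : depends_on_prefix k (avoid k).
Proof. by move=> s s' ss' As m mk; rewrite -ss'//; exact: As. Qed.

(** The sub-probability law at time [k] of the chain killed on entering [B]. *)
Definition avoid_probability k j : R :=
  fine (P [set w | (forall m, (m <= k)%N -> ~ B (Y m w)) /\ Y k w = j]).

Let measurable_avoid_B := measurable_avoid B.

Let measurable_state m i : measurable [set w | Y m w = i].
Proof. exact: (proj1 chainY). Qed.

Lemma avoid_probability_total k :
  fine (P [set w | forall m, (m <= k)%N -> ~ B (Y m w)]) =
  \sum_j avoid_probability k j.
Proof. by rewrite (total_probability _ (Y k)). Qed.

Lemma avoid_probability_ge0 k j : 0 <= avoid_probability k j.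
Proof. by rewrite fine_ge0. Qed.

Lemma avoid_probability_in k j : B j -> avoid_probability k j = 0.
Proof.
move=> Bj; rewrite /avoid_probability [X in P X](_ : _ = set0) ?measure0//.
by apply/seteqP; split=> // w [/(_ k (leqnn k)) + wj]; rewrite wj.
Qed.

Lemma avoid_probability0 j : ~ B j -> avoid_probability 0 j = mu j.
Proof.
move=> Bj; have := proj2 chainY 0%N (fun=> j); rewrite big_ord0 mulr1 => H.
rewrite -[RHS]/(fine (mu j)%:E) -H; congr (fine (P _)).
apply/seteqP; split=> w /= => [[_ wj] m|wj]; first by rewrite leqn0 => /eqP ->.
by split; [move=> m mk; rewrite wj | rewrite wj].
Qed.

Lemma avoid_probabilityS k j : ~ B j ->
  avoid_probability k.+1 j = \sum_i avoid_probability k i * W i j.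
Proof.
move=> Bj.
have mA : measurable [set w | (forall m, (m <= k.+1)%N -> ~ B (Y m w)) /\ Y k.+1 w = j].
  by apply: measurableI; [exact: measurable_avoid_B | exact: measurable_state].
rewrite /avoid_probability (total_probability _ (Y k) _ mA)//.
apply: eq_bigr => i _.
rewrite -(dtmc_markov _ (avoid k) _ _ (avoid_prefix k)); congr (fine (P _)).
apply/seteqP; split=> w /= => [[[Aw wj] wi]|[Aw [wi wj]]].
  by split=> // m mk; apply: Aw; exact: leqW.
split=> //; split=> // m; rewrite leq_eqVlt => /orP[/eqP ->|]; first by rewrite wj.
by rewrite ltnS; exact: Aw.
Qed.

(** The mean of [g] over the killed chain lies in [[0, C]] and drops at each step by at least [c]
    times the survival probability, which is itself nonincreasing. *)
Lemma avoid_probability_bound (g : 'I_n -> R) (c C : R) N :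
  0 <= c -> 0 <= C -> (forall i, 0 <= g i <= C) -> (forall i, B i -> g i = 0) ->
  (forall i, ~ B i -> \sum_j W i j * g j <= g i - c) ->
  N%:R * c * fine (P [set w | forall m, (m <= N)%N -> ~ B (Y m w)]) <= C.
Proof.
move=> c0 C0 gC gB gW.
pose U k := fine (P [set w | forall m, (m <= k)%N -> ~ B (Y m w)]).
pose S k := \sum_j avoid_probability k j * g j.
have step k : S k.+1 <= S k - c * U k.
  (* The recursion for [avoid_probability] is available only off [B]; on [B] the vanishing of [g]
     takes its place. *)
  have -> : S k.+1 = \sum_i avoid_probability k i * \sum_j W i j * g j.
    under [RHS]eq_bigr do rewrite mulr_sumr.
    rewrite exchange_big; apply: eq_bigr => j _ /=.
    have [Bj|Bj] := pselect (B j).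
      by rewrite gB// mulr0 big1// => i _; rewrite !mulr0.
    by rewrite avoid_probabilityS// mulr_suml; apply: eq_bigr => i _; rewrite mulrA.
  rewrite /U avoid_probability_total mulr_sumr -sumrB; apply: ler_sum => i _.
  have [Bi|Bi] := pselect (B i).
    by rewrite avoid_probability_in// !mul0r mulr0 subrr.
  by rewrite [c * _]mulrC -mulrBr ler_wpM2l ?avoid_probability_ge0 ?gW.
have U_decr k : U k.+1 <= U k.
  by apply: fine_probability_le => // w Aw m mk; apply: Aw; exact: leqW.
(* S k + k c U k is nonincreasing in k. *)
have H : S N + N%:R * c * U N <= S 0%N.
  elim: N => [|N IH]; first by rewrite !mul0r addr0.
  apply: le_trans IH.
  have := step N; have : N.+1%:R * c * U N.+1 <= N.+1%:R * c * U N.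
    by rewrite ler_wpM2l ?mulr_ge0.
  rewrite -natr1 !mulrDl !mul1r; lra.
have S0 : 0 <= S N.
  by apply: sumr_ge0 => j _; rewrite mulr_ge0 ?avoid_probability_ge0//; case/andP: (gC j).
have : S 0%N <= C; last by rewrite -/(U N); lra.
have : S 0%N <= C * U 0%N.
  rewrite /U avoid_probability_total mulr_sumr; apply: ler_sum => j _.
  by rewrite mulrC ler_wpM2r ?avoid_probability_ge0//; case/andP: (gC j).
by move/le_trans; apply; rewrite -[leRHS]mulr1 ler_wpM2l ?fine_probability_le1.
Qed.

End avoid.

(** A union bound over the steps. Jumps between two states of [B] count as exits too, because the
    state itself has to be preserved, not just membership in [B]. *)
Lemma exit_probability_bound (B : set 'I_n) (delta : R) N :
  0 <= delta -> (forall b, B b -> 1 - W b b <= delta) ->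
  fine (P [set w | exists2 m, (m < N)%N & B (Y m w) /\ Y m.+1 w <> Y m w])
    <= N%:R * delta.
Proof.
move=> delta0 Wd.
have mY m i : measurable [set w | Y m w = i] := proj1 chainY m i.
have mstep m : measurable [set w | B (Y m w) /\ Y m.+1 w <> Y m w].
  apply: (measurable_prefix_event m.+1 [set s | B (s m) /\ s m.+1 <> s m]).
  by move=> s s' ss' [/= H1 H2]; rewrite -!ss'.
have mE k := measurable_exit B k.
have step m : fine (P [set w | B (Y m w) /\ Y m.+1 w <> Y m w]) <= delta.
  have d1 : \sum_i fine (P [set w | Y m w = i]) = 1.
    rewrite -[RHS]/(fine 1%E) -(probability_setT P) (total_probability _ (Y m))//.
    by apply: eq_bigr => i _; rewrite setTI.
  rewrite (total_probability _ (Y m))// -[leRHS]mul1r -d1 mulr_suml.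
  apply: ler_sum => b _; have [Bb|Bb] := pselect (B b); last first.
    rewrite [X in P X](_ : _ = set0) ?measure0; last first.
      by apply/seteqP; split=> // w [[+ _] wb]; rewrite wb.
    by rewrite mulr_ge0 ?fine_ge0.
  have mbb : measurable [set w | Y m w = b /\ Y m.+1 w = b].
    by apply: measurableI; apply: mY.
  have mbN : measurable [set w | Y m w = b /\ Y m.+1 w <> b].
    by apply: measurableI; [exact: mY | apply: measurableC; exact: mY].
  have E1 : fine (P [set w | Y m w = b /\ Y m.+1 w = b]) =
            fine (P [set w | Y m w = b]) * W b b.
    have := dtmc_markov m setT b b (fun _ _ _ _ => Logic.I).
    rewrite (_ : [set w | _] = [set w | Y m w = b /\ Y m.+1 w = b]); last first.
      by apply/seteqP; split=> w /=; tauto.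
    rewrite (_ : [set w | _ /\ Y m w = b] = [set w | Y m w = b])//.
    by apply/seteqP; split=> w /=; tauto.
  have E2 : fine (P [set w | Y m w = b]) =
      fine (P [set w | Y m w = b /\ Y m.+1 w = b]) +
      fine (P [set w | Y m w = b /\ Y m.+1 w <> b]).
    rewrite -fineD ?fin_num_measure// -measureU//; last first.
      by apply/seteqP; split=> // w [[_ e] [_ /(_ e)]].
    congr (fine (P _)); apply/seteqP; split=> w /= => [wb|]; last tauto.
    by have := pselect (Y m.+1 w = b); tauto.
  rewrite (_ : _ `&` _ = [set w | Y m w = b /\ Y m.+1 w <> b]); last first.
    apply/seteqP; split=> w /= => [[[_ +] wb]|[wb wn]]; first by rewrite wb.
    by rewrite wb.
  have := Wd b Bb; have : 0 <= fine (P [set w | Y m w = b]) by rewrite fine_ge0.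
  move: E2; rewrite E1; nra.
elim: N => [|N IH].
  rewrite mul0r (_ : [set w | _] = set0) ?measure0//.
  by apply/seteqP; split=> // w [].
rewrite -natr1 mulrDl mul1r.
apply: le_trans (lerD IH (step N)); apply: le_trans (fine_probability_setU _ _ _ _ _) => //.
apply: fine_probability_le => //; first exact: measurableU.
move=> w /= [m]; rewrite ltnS leq_eqVlt => /orP[/eqP -> ?|mN ?]; first by right.
by left; exists m.
Qed.

End dtmc.

(** * The Lyapunov function built from almost sure hitting *)

Lemma discrete_hitting_time_lt_pinfty {R : realType} {n : nat} {T : Type}
    (Y : nat -> T -> 'I_n) (B : set 'I_n) (w : T) :
  (discrete_hitting_time R Y B w < +oo)%E <-> exists m, B (Y m w).
Proof.
split=> [/ereal_inf_lt[_ [m Bm _] _]|[m Bm]]; first by exists m.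
apply: le_lt_trans (ltry (m%:R : R)); apply: ereal_inf_lbound.
by exists m.
Qed.

Section potential.
Context {R : realType} {n : nat} {d : measure_display} {T : measurableType d}.
Context {P : 'I_n -> probability T R} {Y : nat -> T -> 'I_n}.
Context {W : 'M[R]_n} {B : set 'I_n}.
Hypothesis chainY : forall i, is_dtmc (P i) Y (point_mass R i) W.

Let survival k i : R := fine (P i [set w | forall m, (m <= k)%N -> ~ B (Y m w)]).

(** Off [B], the powers of this matrix are the avoidance probabilities for all starting states at
    once. Avoidance probabilities satisfy a last-step recursion; matrix powers also give the
    first-step one. *)
Let killed : 'M[R]_n :=
  \matrix_(i, j) if `[< B i >] || `[< B j >] then 0 else W i j.

Let avoid_killed k i j : ~ B i ->
  avoid_probability (P := P i) (Y := Y) B k j = (killed ^+ k) i j.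
Proof.
move=> Bi; elim: k j => [|k IH] j.
  rewrite expr0 !mxE; have [Bj|Bj] := pselect (B j).
    rewrite (avoid_probability_in B)//; case: eqP => // ij.
    by case: Bi; rewrite ij.
  by rewrite (avoid_probability0 (chainY i))// /point_mass eq_sym.
have [Bj|Bj] := pselect (B j).
  rewrite (avoid_probability_in B)// exprSr mxE big1// => l _.
  by rewrite !mxE (asboolT Bj) orbT mulr0.
rewrite (avoid_probabilityS (chainY i))// exprSr mxE; apply: eq_bigr => l _.
rewrite IH !mxE (asboolF Bj) orbF; case: asboolP => // Bl.
by rewrite -IH (avoid_probability_in B)// !mul0r.
Qed.

Let survivalE k i : ~ B i -> survival k i = \sum_j (killed ^+ k) i j.
Proof.
move=> Bi; rewrite /survival (avoid_probability_total (chainY i)).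
by apply: eq_bigr => j _; rewrite avoid_killed.
Qed.

(** Continuity from above: the events of avoiding [B] up to [k] decrease to the null event of never
    hitting [B]. *)
Let survival_cvg i : ~ B i ->
  P i [set w | (discrete_hitting_time R Y B w < +oo)%E] = 1%E ->
  survival k i @[k --> \oo] --> 0.
Proof.
move=> Bi hit.
have mS k := measurable_avoid (chainY i) B k.
pose S k := [set w | forall m, (m <= k)%N -> ~ B (Y m w)].
have capS : \bigcap_k S k = ~` [set w | (discrete_hitting_time R Y B w < +oo)%E].
  apply/seteqP; split=> w /=.
    by move=> Sw /discrete_hitting_time_lt_pinfty[m]; exact: (Sw m Logic.I m).
  by move=> Hw k _ m mk Bm; apply: Hw; apply/discrete_hitting_time_lt_pinfty; exists m.
have mH : measurable [set w | (discrete_hitting_time R Y B w < +oo)%E].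
  rewrite -[X in measurable X]setCK -capS; apply: measurableC.
  by apply: bigcap_measurable => [|k _]; [exists 0%N | exact: mS].
have P0 : P i (\bigcap_k S k) = 0%E by rewrite capS probability_setC// hit subee.
have : (P i \o S) k @[k --> \oo] --> P i (\bigcap_k S k).
  apply: nonincreasing_cvg_mu => //.
  - by rewrite (le_lt_trans (probability_le1 _ _)) ?ltry//; exact: mS.
  - by rewrite capS; exact: measurableC.
  - move=> k l kl; apply/subsetPset => w Sw m mk; apply: Sw; exact: leq_trans kl.
rewrite P0 => /fine_cvgP[_]; exact.
Qed.

(** Here [g i] is a truncated mean hitting time, the sum of P_i(T_B > k) over k < K. Off [B],
    applying [W] shifts the index by one, so the sum telescopes to [g - 1 + v K], and [K] is chosen
    to make [v K] at most 1/2. *)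
Lemma hitting_potential :
  (forall i, ~ B i -> P i [set w | (discrete_hitting_time R Y B w < +oo)%E] = 1%E) ->
  exists (g : 'I_n -> R) (C : R),
    [/\ 0 <= C, forall i, 0 <= g i <= C, forall i, B i -> g i = 0 &
      forall i, ~ B i -> \sum_j W i j * g j <= g i - 2^-1].
Proof.
move=> hit.
(* Finiteness of the state space gives one truncation level for all starting states. *)
have : \forall k \near \oo, forall i, ~ B i -> survival k i <= 2^-1.
  apply: filter_forall => i; have [Bi|Bi] := pselect (B i).
    by apply: nearW.
  near=> k => _; apply/ltW; near: k.
  by apply: (cvgr_lt _ (survival_cvg i Bi (hit i Bi))); rewrite invr_gt0.
move=> [K _ /(_ K (leqnn K)) SK].
pose v k i := if `[< B i >] then 0 else survival k i.
have v_ge0 k i : 0 <= v k i.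
  by rewrite /v; case: asboolP => // _; rewrite fine_ge0.
pose g i := \sum_(k < K) v k i.
have g_ge0 i : 0 <= g i by apply: sumr_ge0 => k _; exact: v_ge0.
exists g, (\sum_i g i); split=> [|i|i Bi|i Bi].
- by apply: sumr_ge0 => i _; exact: g_ge0.
- by rewrite g_ge0 (bigD1 i)//= lerDl sumr_ge0// => j _; exact: g_ge0.
- by rewrite /g big1// => k _; rewrite /v asboolT.
(* First-step decomposition, read off from the product of [killed] and its [k]-th power; the columns
   in [B] drop out because [v] is zero there. *)
have vS k : \sum_j W i j * v k j = v k.+1 i.
  rewrite /v asboolF// survivalE// exprS.
  under [RHS]eq_bigr do rewrite mxE.
  rewrite exchange_big /=; apply: eq_bigr => l _; rewrite -mulr_sumr mxE.
  rewrite (asboolF Bi)/=; case: asboolP => Bl; first by rewrite mulr0 mul0r.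
  by rewrite survivalE.
have -> : \sum_j W i j * g j = \sum_(k < K) v k.+1 i.
  under eq_bigr do rewrite mulr_sumr.
  by rewrite exchange_big; apply: eq_bigr => k _; rewrite vS.
have v0 : v 0%N i = 1.
  rewrite /v asboolF// survivalE// expr0 (bigD1 i)//= !mxE eqxx big1 ?addr0// => j ji.
  by rewrite mxE eq_sym (negbTE ji).
(* Both sides are the sum of [v k i] over [k <= K], split at either end. *)
have : \sum_(k < K) v k.+1 i + v 0%N i = g i + v K i.
  by rewrite /g -(big_ord_recr K (v^~ i)) big_ord_recl addrC.
have : v K i <= 2^-1 by rewrite /v asboolF//; exact: SK.
rewrite v0; lra.
Unshelve. all: end_near.
Qed.

End potential.

(** * Short-time expansion of the transition function *)

Lemma normr_expmx_le {R : realType} {n : nat} (A : 'M[R]_n) (K : R) k i j :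
  (forall i, \sum_j `|A i j| <= K) -> `|(A ^+ k) i j| <= K ^+ k.
Proof.
move=> AK; have K0 : 0 <= K by apply: le_trans (AK i); exact: sumr_ge0.
elim: k i => [|k IH] i.
  by rewrite !expr0 mxE; case: (i == j); rewrite ?normr1 ?normr0.
rewrite !exprS mxE; apply: le_trans (ler_norm_sum _ _ _) _.
apply: le_trans (ler_wpM2r (exprn_ge0 k K0) (AK i)).
rewrite mulr_suml; apply: ler_sum => l _.
by rewrite normrM ler_wpM2l.
Qed.

(** Entries of the k-th power of [h *: Q] are at most [(h * K) ^+ k], and [h ^+ k <= h ^+ 2] for k
    >= 2 because [h <= 1]; so the terms past the linear one sum to at most [expR K * h ^+ 2]. *)
Lemma transition_function_expansion {R : realType} {n : nat} (Q : 'M[R]_n) :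
  exists C : R, 0 <= C /\ forall h : R, 0 <= h <= 1 -> forall i j,
    `|transition_function Q h i j - ((i == j)%:R + h * Q i j)| <= C * h ^+ 2.
Proof.
pose K := \sum_i \sum_j `|Q i j|.
have K0 : 0 <= K by apply: sumr_ge0 => i _; exact: sumr_ge0.
exists (expR K); split=> [|h /andP[h0 h1] i j]; first exact: expR_ge0.
pose u (k : nat) : R := ((h *: Q) ^+ k) i j / (k`!)%:R.
have uK k : `|u k| <= exp_coeff (h * K) k.
  rewrite /u normrM normfV (ger0_norm (ler0n _ _)) /exp_coeff/= ler_wpM2r//.
  apply: normr_expmx_le => l.
  have -> : \sum_j0 `|(h *: Q) l j0| = h * \sum_j0 `|Q l j0|.
    by rewrite mulr_sumr; apply: eq_bigr => m _; rewrite mxE normrM ger0_norm.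
  rewrite ler_wpM2l// /K [leRHS](bigD1 l)//= lerDl sumr_ge0// => m _; exact: sumr_ge0.
have cu : cvgn (series u).
  apply: normed_cvg; apply: series_le_cvg (is_cvg_series_exp_coeff (h * K)) => [k|k|k].
  - exact: normr_ge0.
  - by rewrite exp_coeff_ge0 ?mulr_ge0.
  - exact: uK.
have near_bound : \forall m \near \oo,
    `|series u m - ((i == j)%:R + h * Q i j)| <= expR K * h ^+ 2.
  exists 2%N => // m /= m2.
  rewrite /series/= (big_cat_nat _ m2)//= big_nat_recr//= big_nat1.
  rewrite {1 2}/u expr0 expr1 !mxE fact0 !divr1 [_ + \sum_(2 <= _ < _) _]addrC addrK.
  have s_le : series (exp_coeff K) m <= expR K.
    rewrite /expR; apply: nondecreasing_cvgn_le; last exact: is_cvg_series_exp_coeff.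
    apply/nondecreasing_seqP => k.
    by rewrite /series/= big_nat_recr//= lerDl exp_coeff_ge0.
  apply: le_trans (ler_wpM2r (exprn_ge0 2 h0) s_le).
  apply: le_trans (ler_norm_sum _ _ _) _.
  rewrite /series/= [X in _ <= X * _](big_cat_nat _ m2)//= mulrDl.
  rewrite -[leLHS]add0r lerD//.
    by rewrite mulr_ge0 ?exprn_ge0// sumr_ge0// => k _; exact: exp_coeff_ge0.
  rewrite mulr_suml big_nat_cond [leRHS]big_nat_cond; apply: ler_sum => k /andP[/andP[k2 _] _].
  apply: le_trans (uK k) _; rewrite /exp_coeff/= exprMn.
  rewrite -mulrA [X in _ <= X]mulrC ler_wpM2r ?divr_ge0 ?exprn_ge0//.
  by rewrite -(subnKC k2) exprD ler_piMr ?exprn_ge0// exprn_ile1.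
have lower : (i == j)%:R + h * Q i j - expR K * h ^+ 2 <= limn (series u).
  apply: (limr_ge cu); apply: filterS near_bound => m.
  by rewrite ler_norml => /andP[+ _]; lra.
have upper : limn (series u) <= (i == j)%:R + h * Q i j + expR K * h ^+ 2.
  apply: (limr_le cu); apply: filterS near_bound => m.
  by rewrite ler_norml => /andP[_]; lra.
rewrite [X in `|X - _|]mxE -/u ler_norml; apply/andP; split; lra.
Qed.

(** * First passage of right-continuous paths, and grids *)

Lemma right_constant {R : realType} {n : nat} (x : R -> 'I_n) (s : R) :
  (\forall u \near s^'+, x u = x s) ->
  exists2 e : R, 0 < e & forall u, s <= u < s + e -> x u = x s.
Proof.
move=> [e /= e0 He]; exists e => // u /andP[]; rewrite le_eqVlt => /orP[/eqP ->//|su] ue.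
by apply: He => //=; rewrite ltr0_norm ?subr_lt0// opprB ltrBlDl.
Qed.

(** Right-continuity makes the infimum attained, so the extended-real infimum can be replaced by an
    actual first time in [B]. *)
Lemma first_passageP {R : realType} {n : nat} {T : Type} (X : R -> T -> 'I_n)
    (B : set 'I_n) (w : T) (i : 'I_n) :
  (forall t, 0 <= t -> \forall u \near t^'+, X u w = X t w) ->
  ((first_passage_time X B w < +oo)%E /\ X (fine (first_passage_time X B w)) w = i)
  <-> exists s, [/\ 0 <= s, B (X s w), X s w = i &
        forall u, 0 <= u < s -> ~ B (X u w)].
Proof.
move=> rc; split=> [[]|[s [s0 Bs <- sB]]].
  set fpt := first_passage_time X B w => fpt_oo fpti.
  have fpt0 : (0 <= fpt)%E by apply: le_ereal_inf_tmp => _ [u [u0 _] <-]; rewrite lee_fin.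
  have fptE : fpt = (fine fpt)%:E by rewrite fineK// ge0_fin_numE.
  have tau0 : 0 <= fine fpt by exact: fine_ge0.
  have before u : 0 <= u < fine fpt -> ~ B (X u w).
    move=> /andP[u0 ut] Bu; have : (fpt <= u%:E)%E by apply: ereal_inf_lbound; exists u.
    by rewrite fptE lee_fin leNgt ut.
  exists (fine fpt); split=> //.
  (* The state is constant on an interval of length [e] starting at the infimum, and some visit to
     [B] falls in that interval. *)
  have [e e0 He] := right_constant (X^~ w) _ (rc _ tau0).
  have : (fpt < (fine fpt + e)%:E)%E by rewrite {1}fptE lte_fin ltrDl.
  move=> /ereal_inf_lt[_ [s [s0 Bs] <-]]; rewrite lte_fin => se.
  rewrite -(He s)// se andbT leNgt; apply/negP => st.
  by apply: (before s) => //; rewrite s0.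
have -> : first_passage_time X B w = s%:E; last by split=> //; exact: ltry.
apply/eqP; rewrite eq_le; apply/andP; split; first by apply: ereal_inf_lbound; exists s.
apply: le_ereal_inf_tmp => _ [u [u0 Bu] <-]; rewrite lee_fin leNgt; apply/negP => us.
by apply: (sB u) => //; rewrite u0.
Qed.

(** Once the mesh is below the length [e] of an interval of constancy starting at [s], the first
    grid point at or after [s] falls in it, and all earlier ones precede [s]. The grid continues
    past [t], so [s] may exceed [t]. *)
Lemma grid_first_hit {R : realType} {n : nat} (x : R -> 'I_n) (B : set 'I_n)
    (t s : R) :
  0 < t -> (\forall u \near s^'+, x u = x s) -> 0 <= s ->
  (forall u, 0 <= u < s -> ~ B (x u)) ->
  \forall N \near \oo, exists k,
    x (k%:R * (t / N.+1%:R)) = x s /\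
    forall m, (m < k)%N -> ~ B (x (m%:R * (t / N.+1%:R))).
Proof.
move=> t0 /right_constant[e e0 He] s0 sB.
have et0 : 0 < e / t by rewrite divr_gt0.
near=> N.
set h := t / N.+1%:R.
have h0 : 0 < h by rewrite divr_gt0.
have he : h < e.
  rewrite /h mulrC -ltr_pdivlMr//; near: N.
  exact: (near_infty_natSinv_lt (PosNum et0)).
have ex_k : exists k, s <= k%:R * h.
  exists (Num.bound (s / h)); rewrite -ler_pdivrMr// ltW//.
  by apply: archi_boundP; rewrite divr_ge0// ltW.
have [k sk k_min] := ex_minnP ex_k.
have before m : (m < k)%N -> m%:R * h < s.
  by rewrite ltnNge ltNge; apply: contra; exact: k_min.
exists k; split; last first.
  by move=> m /before mk; apply: sB; rewrite mk mulr_ge0// ltW.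
apply: He; rewrite sk/=; case: k sk k_min before => [|k] sk _ before.
  by rewrite mul0r ltr_pwDr.
by have := before k (ltnSn k); rewrite -natr1 mulrDl mul1r; lra.
Unshelve. all: end_near.
Qed.

(** * Skeleton chains and the law at first passage *)

Lemma ctmc_skeleton {R : realType} {n : nat} {d : measure_display}
    {T : measurableType d} (P : probability T R) (X : R -> T -> 'I_n)
    (mu : 'I_n -> R) (Q : 'M[R]_n) (h : R) :
  0 <= h -> is_ctmc P X mu Q ->
  is_dtmc P (fun m w => X (m%:R * h) w) mu (transition_function Q h).
Proof.
move=> h0 ctX; split=> [m i|k s].
  by apply: (ctmc_measurable ctX); rewrite mulr_ge0.
rewrite (ctmc_fdd ctX (t := fun m => m%:R * h) k s) ?mul0r//.
  by congr (_ * _)%:E; apply: eq_bigr => m _; rewrite -mulrBl -natr1 addrC addKr mul1r.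
by move=> m; rewrite ler_wpM2r// ler_nat.
Qed.

Section first_passage_law.
Context {R : realType} {n : nat} {d : measure_display} {T : measurableType d}.
Context {P : probability T R} {X : R -> T -> 'I_n} {mu : 'I_n -> R} {Q : 'M[R]_n}.
Variables (B : set 'I_n) (t : R).
Hypothesis t0 : 0 < t.
Hypothesis ctX : is_ctmc P X mu Q.

Let Y N m w := X (m%:R * (t / N.+1%:R)) w.

Let chainY N : is_dtmc P (Y N) mu (transition_function Q (t / N.+1%:R)).
Proof. by apply: ctmc_skeleton => //; rewrite divr_ge0// ltW. Qed.

Let rc w s : 0 <= s -> \forall u \near s^'+, X u w = X s w.
Proof. exact: (ctmc_right_continuous ctX w). Qed.

Let YN N w : Y N N.+1 w = X t w.
Proof. by rewrite /Y mulrC divfK. Qed.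

(* Off this event X t is the state of the skeleton at its first visit to B. *)
Definition skeleton_misses (N : nat) : set T :=
  [set w | forall m, (m <= N.+1)%N -> ~ B (Y N m w)] `|`
  [set w | exists2 m, (m < N.+1)%N & B (Y N m w) /\ Y N m.+1 w <> Y N m w].

Let measurable_misses N : measurable (skeleton_misses N).
Proof.
by apply: measurableU; [exact: (measurable_avoid (chainY N)) | exact: (measurable_exit (chainY N))].
Qed.

Let D i := [set w | (first_passage_time X B w < +oo)%E /\
                    X (fine (first_passage_time X B w)) w = i].

Let DP w i : D i w <-> exists s, [/\ 0 <= s, B (X s w), X s w = i &
                                    forall u, 0 <= u < s -> ~ B (X u w)].
Proof. by apply: first_passageP => s s0; exact: rc. Qed.

Let hitD w s : 0 <= s -> B (X s w) -> exists i, D i w.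
Proof.
move=> s0 Bs; exists (X (fine (first_passage_time X B w)) w); split=> //.
by apply: le_lt_trans (ltry s); apply: ereal_inf_lbound; exists s.
Qed.

Let D_inj w i j : D i w -> D j w -> i = j.
Proof. by move=> [_ <-] [_ <-]. Qed.

Let Z N i := [set w | exists k, [/\ B i, Y N k w = i & forall m, (m < k)%N -> ~ B (Y N m w)]].

Let Z_inj N w i j : Z N i w -> Z N j w -> i = j.
Proof.
move=> [k [Bi ki kB]] [l [Bj lj lB]].
have [kl|lk|kl] := ltngtP k l; last by rewrite -ki -lj kl.
  by case: (lB _ kl); rewrite ki.
by case: (kB _ lk); rewrite lj.
Qed.

Let D_Z w i : D i w -> \forall N \near \oo, Z N i w.
Proof.
move=> Di; have [s [s0 Bs <- sB]] := (DP w i).1 Di.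
have H := grid_first_hit (X^~ w) B t s t0 (rc w s s0) s0 sB.
apply: filterS H => N [k [kE kB]]; exists k; split=> //.
Qed.

(** [D i] is the lower limit of the events [Z N i], which yields its measurability. For the reverse
    inclusion, a grid visit to [B] forces some [D j]; then [Z N i] and [Z N j] hold together for
    large [N], whence [i = j]. *)
Let DZ i : D i = \bigcup_N0 \bigcap_(N in [set N | (N0 <= N)%N]) Z N i.
Proof.
apply/seteqP; split=> w.
  by move=> /D_Z[N0 _ H]; exists N0 => // N /= N0N; exact: H.
move=> [N0 _ H]; have [k [Bi Yi _]] := H N0 (leqnn N0).
have [||j Dj] := hitD w (k%:R * (t / N0.+1%:R)).
- by rewrite mulr_ge0// divr_ge0// ltW.
- by move: Bi; rewrite -Yi.
have [N1 _ H1] := D_Z w j Dj.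
rewrite (_ : i = j)//; apply: (Z_inj (maxn N0 N1) w).
  by apply: H; rewrite /= leq_maxl.
by apply: H1; rewrite /= leq_maxr.
Qed.

Let measurable_Z N i : measurable (Z N i).
Proof.
rewrite (_ : Z N i = \bigcup_k
  [set w | [/\ B i, Y N k w = i & forall m, (m < k)%N -> ~ B (Y N m w)]]).
  apply: bigcup_measurable => k _.
  apply: (measurable_prefix_event (chainY N) k
    [set s | [/\ B i, s k = i & forall m, (m < k)%N -> ~ B (s m)]]).
  move=> s s' ss' [/= Bi si sB]; rewrite -ss'//; split=> // m mk.
  by rewrite -ss' ?(ltnW mk)//; exact: sB.
by apply/seteqP; split=> [w [k Hk]|w [k _ Hk]]; exists k.
Qed.

Let measurable_D i : measurable (D i).
Proof.
rewrite DZ; apply: bigcup_measurable => N0 _.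
by apply: bigcap_measurable => [|N _]; [exists N0 => /= | exact: measurable_Z].
Qed.

(** The union of these events is the lower limit of [skeleton_misses]: outside it, infinitely many
    skeletons do not miss. *)
Let G N0 := \bigcap_(N in [set N | (N0 <= N)%N]) skeleton_misses N.

Let measurable_G N0 : measurable (G N0).
Proof. by apply: bigcap_measurable => [|N _]; [exists N0 => /=|]. Qed.

Let measurable_L : measurable (\bigcup_N0 G N0).
Proof. by apply: bigcup_measurable => N0 _. Qed.

(** Among the infinitely many skeletons that do not miss, take one fine enough to enter [B] first at
    the first-passage state [j]. It enters by step [N.+1] and then stays at [j] until that step,
    which is time [t]. *)
Let outside_L w i : ~ (\bigcup_N0 G N0) w -> (X t w = i <-> D i w).
Proof.
move=> nL.
have hit N0 : exists2 N, (N0 <= N)%N & ~ skeleton_misses N w.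
  apply: contrapT => H; apply: nL; exists N0 => // N N0N.
  by apply: contrapT => H'; apply: H; exists N.
have hitY N : ~ skeleton_misses N w -> exists2 m, (m <= N.+1)%N & B (Y N m w).
  move=> nm; apply: contrapT => H; apply: nm; left => m mN Bm.
  by apply: H; exists m.
have [M _ nM] := hit 0%N; have [m _ Bm] := hitY M nM.
have [|//|j Dj] := hitD w (m%:R * (t / M.+1%:R)).
  by rewrite mulr_ge0// divr_ge0// ltW.
have [N1 _ HZ] := D_Z w j Dj; have [N N1N nN] := hit N1.
have [k [Bj Yk kB]] := HZ N N1N.
have [k0 k0N Bk0] := hitY N nN.
have kk0 : (k <= k0)%N by rewrite leqNgt; apply/negP => /kB.
have stay l : (k + l <= N.+1)%N -> Y N (k + l)%N w = j.
  elim: l => [|l IH] kl; first by rewrite addn0.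
  rewrite addnS in kl *; apply: contrapT => H; apply: nN; right.
  by exists (k + l)%N => //; rewrite IH ?(ltnW kl).
have XtE : X t w = j.
  by rewrite -(YN N) -(stay (N.+1 - k)%N) subnKC// (leq_trans kk0).
by rewrite XtE; split=> [<-//|Di]; exact: (D_inj w _ _ Dj Di).
Qed.

(** Fatou for a lower limit of events: [G N0] increases to the union, and each [G N0] lies in
    [skeleton_misses N] for all large [N]. *)
Let probability_L delta :
  (\forall N \near \oo, fine (P (skeleton_misses N)) <= delta) ->
  fine (P (\bigcup_N0 G N0)) <= delta.
Proof.
move=> [N1 _ HN].
have : (P \o G) N @[N --> \oo] --> P (\bigcup_N0 G N0).
  apply: nondecreasing_cvg_mu => //.
  move=> k l kl; apply/subsetPset => w Gw N lN; apply: Gw => /=.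
  exact: leq_trans lN.
move=> cG; have : (P (\bigcup_N0 G N0) <= delta%:E)%E.
  rewrite -(cvg_lim _ cG)//; apply: lime_le; first by apply/cvg_ex; eexists; exact: cG.
  apply: nearW => N0 /=; apply: (@le_trans _ _ (P (skeleton_misses (maxn N0 N1)))).
    apply: le_measure; rewrite ?inE//.
    by move=> w; apply; rewrite /= leq_maxl.
  by rewrite -[leLHS]fineK ?fin_num_measure// lee_fin; apply: HN; rewrite /= leq_maxr.
by move=> H; rewrite -lee_fin fineK ?fin_num_measure.
Qed.

Lemma law_at_first_passage_close delta i :
  (\forall N \near \oo, fine (P (skeleton_misses N)) <= delta) ->
  `|law_at P X t i - law_at_first_passage P X B i| <= delta.
Proof.
move=> /probability_L PL; rewrite /law_at /law_at_first_passage -/(D i).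
have mX : measurable [set w | X t w = i] by apply: (ctmc_measurable ctX); rewrite ltW.
have XD : fine (P [set w | X t w = i]) <= fine (P (D i)) + fine (P (\bigcup_N0 G N0)).
  apply: le_trans (fine_probability_setU P _ _ _ _) => //.
  apply: fine_probability_le => //; first exact: measurableU.
  move=> w Xw; have [|nL] := pselect ((\bigcup_N0 G N0) w); first by right.
  by left; apply/(outside_L w).
have DX : fine (P (D i)) <= fine (P [set w | X t w = i]) + fine (P (\bigcup_N0 G N0)).
  apply: le_trans (fine_probability_setU P _ _ _ _) => //.
  apply: fine_probability_le => //; first exact: measurableU.
  move=> w Dw; have [|nL] := pselect ((\bigcup_N0 G N0) w); first by right.
  by left; apply/(outside_L w).
by rewrite ler_norml; apply/andP; split; lra.
Qed.

End first_passage_law.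

(** The two terms bound the two ways a skeleton can miss: the first, from the Lyapunov function [g],
    not reaching [B] by time [t]; the second, from the exit rates, leaving a state of [B] before
    [t]. *)
Lemma ctmc_first_passage_estimate {R : realType} {n : nat} {d : measure_display}
    {T : measurableType d} (P : probability T R) (X : R -> T -> 'I_n)
    (mu : 'I_n -> R) (Q : 'M[R]_n) (B : set 'I_n) (g : 'I_n -> R)
    (t c G K : R) (i : 'I_n) :
  is_ctmc P X mu Q -> 0 < t -> 0 < c -> 0 <= G -> 0 <= K ->
  (forall j, 0 <= g j <= G) -> (forall j, B j -> g j = 0) ->
  (forall j, ~ B j -> \sum_k Q j k * g k <= - c) ->
  (forall j, B j -> exit_rate Q j <= K) ->
  `|law_at P X t i - law_at_first_passage P X B i|
    <= 2 * G / (c * t) + t * (K + 1).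
Proof.
move=> ctX t0 c0 G0 K0 gG gB Qg QK.
apply: (law_at_first_passage_close B t t0 ctX).
have [C [C0 HC]] := transition_function_expansion Q.
pose S := \sum_j g j.
have S0 : 0 <= S by apply: sumr_ge0 => j _; case/andP: (gG j).
(* One condition [h * M < 1] yields [h <= 1], [C * h <= 1] and [C * h * S <= c / 2]; the last two
   absorb the quadratic remainder. *)
pose M := 1 + C + 2 * C * S / c.
have M1 : 1 <= M by rewrite /M -addrA lerDl addr_ge0// divr_ge0 ?mulr_ge0// ltW.
have M0 : 0 < M / t by rewrite divr_gt0// (lt_le_trans _ M1).
have Mt0 : 0 < (M * t)^-1 by rewrite invr_gt0 mulr_gt0// (lt_le_trans _ M1).
near=> N.
set h := t / N.+1%:R.
have h0 : 0 < h by rewrite divr_gt0.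
have hM : h * M < 1.
  have -> : h * M = M * t * N.+1%:R^-1 by rewrite /h; ring.
  rewrite -ltr_pdivlMl ?mulr1; last by rewrite -invr_gt0.
  near: N; exact: (near_infty_natSinv_lt (PosNum Mt0)).
have h1 : 0 <= h <= 1 by rewrite ltW//=; nra.
have hC : C * h <= 1.
  have : 0 <= 2 * C * S / c by rewrite divr_ge0 ?mulr_ge0// ltW.
  by move: hM; rewrite /M; nra.
have hCS : C * h * S <= c / 2.
  have : h * (2 * C * S / c) <= 1.
    by apply: le_trans (ltW hM); rewrite ler_wpM2l ?(ltW h0)// /M lerDr addr_ge0.
  rewrite mulrA ler_pdivrMr// mul1r; lra.
have Nh : N.+1%:R * h = t by rewrite /h mulrC divfK.
have chain : is_dtmc P (fun m w => X (m%:R * h) w) mu (transition_function Q h).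
  by apply: ctmc_skeleton => //; exact: ltW.
apply: le_trans (fine_probability_setU P _ _ _ _) _.
- exact: (measurable_avoid chain).
- exact: (measurable_exit chain).
apply: lerD; last first.
  (* One step leaves a state of [B] with probability at most [h * K + C * h ^+ 2], hence at most
     [h * (K + 1)]. *)
  have := exit_probability_bound chain B (h * (K + 1)) N.+1.
  rewrite mulrA Nh; apply; first by rewrite mulr_ge0 ?addr_ge0// ltW.
  move=> b Bb; have := HC h h1 b b; rewrite eqxx ler_norml => /andP[+ _].
  have := ler_wpM2l (ltW h0) hC; have := ler_wpM2l (ltW h0) (QK b Bb).
  rewrite /exit_rate expr2 mulr1n; lra.
(* Half of the drift [h * c] is kept; the other half pays for the remainder [C * h ^+ 2 * S]. *)
have := avoid_probability_bound chain B g (h * (c / 2)) G N.+1.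
move=> /(_ _ _ gG gB) H.
rewrite ler_pdivlMr ?mulr_gt0//.
suff : t * (c / 2) * fine (P [set w | forall m, (m <= N.+1)%N -> ~ B (X (m%:R * h) w)]) <= G.
  by set p := fine _; lra.
rewrite -Nh -[_ * h * _]mulrA; apply: H => //; first by rewrite mulr_ge0 ?divr_ge0// ltW.
move=> j Bj.
have -> : g j - h * (c / 2) = (g j + h * - c) + h * (c / 2) by lra.
have Wg : \sum_k transition_function Q h j k * g k <=
    \sum_k ((j == k)%:R + h * Q j k + C * h ^+ 2) * g k.
  apply: ler_sum => k _; apply: ler_wpM2r; first by case/andP: (gG k).
  by have := HC h h1 j k; rewrite ler_norml => /andP[_]; rewrite lerBlDl.
apply: le_trans Wg _.
under eq_bigr do rewrite !mulrDl -[h * _ * _]mulrA.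
rewrite !big_split/= -!mulr_sumr; apply: lerD; first apply: lerD.
- rewrite (bigD1 j)//= eqxx mul1r big1 ?addr0// => k kj.
  by rewrite eq_sym (negbTE kj) mul0r.
- by rewrite ler_wpM2l ?(ltW h0)//; exact: Qg.
- by rewrite -/S expr2 mulrA [_ * h * S]mulrAC [leRHS]mulrC ler_wpM2r ?(ltW h0)// mulrAC.
Unshelve. all: end_near.
Qed.

(** * Limits of exit rates and jump probabilities *)

Lemma cvg_sumr {R : realType} {T : Type} {F : set_system T} {FF : Filter F}
    {I : finType} (p : pred I) (f : I -> T -> R) (a : I -> R) :
  (forall i, p i -> f i x @[x --> F] --> a i) ->
  \sum_(i | p i) f i x @[x --> F] --> \sum_(i | p i) a i.
Proof. by move=> H; apply: (cvg_big _ _ H); exact: add_continuous. Qed.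

Section limits.
Context {R : realType} {n : nat} {Q : R -> 'M[R]_n}.
Hypothesis Q_rate : forall l : R, 0 < l -> is_rate_matrix (Q l).
Hypothesis Q_limit : forall i j : 'I_n, i != j ->
  exists L : \bar R, (0 <= L)%E /\ ((Q l i j)%:E @[l --> +oo] --> L).

Lemma exit_rateE l i : 0 < l -> exit_rate (Q l) i = \sum_(j | j != i) Q l i j.
Proof.
move=> l0; have [_ /(_ i)] := Q_rate l l0.
by rewrite (bigD1 i)//= /exit_rate => /eqP; rewrite addrC addr_eq0 => /eqP ->.
Qed.

(** The [lim] in [limit_exit_rate] is a genuine limit: the exit rate is a finite sum of nonnegative
    rates with limits in [[0, +oo]], where sums pass to the limit. *)
Lemma exit_rate_cvg i :
  (exit_rate (Q l) i)%:E @[l --> +oo] --> limit_exit_rate Q i.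
Proof.
have [L HL] : exists L : 'I_n -> \bar R,
    forall j, j != i -> (Q l i j)%:E @[l --> +oo] --> L j.
  have /choice[L HL] : forall j, exists L : \bar R,
      j != i -> (Q l i j)%:E @[l --> +oo] --> L.
    move=> j; case: (eqVneq j i) => [_|ji]; first by exists 0%E.
    have ij : i != j by rewrite eq_sym.
    by have [L [_ HL]] := Q_limit i j ij; exists L.
  by exists L.
suff H : (exit_rate (Q l) i)%:E @[l --> +oo] --> (\sum_(j | j != i) L j)%E.
  by rewrite /limit_exit_rate (cvg_lim _ H).
have Q_ge0 j : j != i -> \forall l \near +oo, (0 <= (Q l i j)%:E)%E.
  move=> ji; near=> l; have l0 : 0 < l by near: l; exact: nbhs_pinfty_gt.
  by rewrite lee_fin; apply: (proj1 (Q_rate l l0)); rewrite eq_sym.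
apply: cvg_trans (cvg_nnesum (r := index_enum 'I_n) Q_ge0 HL).
apply: near_eq_cvg; near=> l.
have l0 : 0 < l by near: l; exact: nbhs_pinfty_gt.
by rewrite exit_rateE// sumEFin.
Unshelve. all: end_near.
Qed.

Lemma slow_exit_rate_bounded :
  exists2 K : R, 0 <= K & \forall l \near +oo,
    forall i, slow_states Q i -> exit_rate (Q l) i <= K.
Proof.
have H i : exists K : R, 0 <= K /\ (slow_states Q i ->
    \forall l \near +oo, exit_rate (Q l) i <= K).
  have [si|si] := pselect (slow_states Q i); last by exists 0; split.
  have := exit_rate_cvg i; move: si; rewrite /slow_states/=.
  case: (limit_exit_rate Q i) => [r _|//|_].
    move=> /fine_cvgP[_ cr]; exists (`|r| + 1); split=> [|_]; first by rewrite addr_ge0.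
    have r1 : r < `|r| + 1 by rewrite (le_lt_trans (ler_norm r))// ltrDl.
    by apply: filterS (cvgr_lt _ cr _ r1) => l; exact: ltW.
  (* The value [-oo] also satisfies the defining inequality of [slow_states]; the rate would then be
     eventually negative, so 0 bounds it. *)
  move=> /cvgeNy_lt /(_ 0) cr; exists 0; split=> // _.
  by apply: filterS cr => l; rewrite lte_fin => /ltW.
have [K HK] := choice H; exists (\sum_i K i).
  by apply: sumr_ge0 => i _; have [] := HK i.
apply: filter_forall => i; have [si|si] := pselect (slow_states Q i); last exact: nearW.
have [_ /(_ si)] := HK i; apply: filterS => l Hl _; apply: le_trans Hl _.
by rewrite (bigD1 i)//= lerDl sumr_ge0// => j _; have [] := HK j.
Qed.

Lemma fast_exit_rate_cvg i : ~ slow_states Q i ->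
  exit_rate (Q l) i @[l --> +oo] --> +oo.
Proof.
rewrite /slow_states/= => /negP; rewrite ltey negbK => /eqP fi.
by have := exit_rate_cvg i; rewrite fi => /cvgeryP.
Qed.

End limits.

Lemma jump_matrix_cvg {R : realType} {n : nat} (Q : R -> 'M[R]_n) (i j : 'I_n) :
  (i != j -> cvg (jump_matrix (Q l) i j @[l --> +oo])) ->
  jump_matrix (Q l) i j @[l --> +oo] --> limit_jump_matrix Q i j.
Proof.
move=> H; rewrite mxE; have [ij|/H//] := eqVneq i j.
suff H0 : jump_matrix (Q l) i j @[l --> +oo] --> (0 : R).
  by rewrite (cvg_lim _ H0).
have -> : (fun l => jump_matrix (Q l) i j) = (fun=> 0).
  by apply/funext => l; rewrite mxE ij eqxx.
exact: cvg_cst.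
Qed.

(** This is [Q = diag(q)(Omega - I)]: a drift of the jump chain becomes a drift of the rate matrix
    multiplied by the exit rate. *)
Lemma rate_jump_matrix {R : realType} {n : nat} (Q : 'M[R]_n) (g : 'I_n -> R) i :
  0 < exit_rate Q i ->
  \sum_j Q i j * g j = exit_rate Q i * (\sum_j jump_matrix Q i j * g j - g i).
Proof.
move=> q0; rewrite mulrBr mulr_sumr (bigD1 i)//= [X in _ = X - _](bigD1 i)//=.
rewrite mxE eqxx mul0r mulr0 add0r addrC {2}/exit_rate mulNr opprK; congr (_ + _).
apply: eq_bigr => j ji; rewrite mxE eq_sym (negbTE ji).
by rewrite mulrA [exit_rate _ _ * _]mulrC divfK// gt_eqF.
Qed.

(** * Choice of the time and conclusion *)

Theorem theorem4 (R : realType) (n : nat) (Q : R -> 'M[R]_n)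
  (Q_rate : forall l : R, 0 < l -> is_rate_matrix (Q l))
  (Q_irreducible : forall l : R, 0 < l -> irreducible_rates (Q l))
  (Q_limit : forall i j : 'I_n, i != j ->
     exists L : \bar R, (0 <= L)%E /\ ((Q l i j)%:E @[l --> +oo] --> L))
  (slow_nonempty : slow_states Q !=set0)
  (slow_positive : forall i : 'I_n, slow_states Q i ->
     (0 < limit_exit_rate Q i)%E)
  (jump_limit : forall i j : 'I_n, i != j ->
     cvg (jump_matrix (Q l) i j @[l --> +oo]))
  (d' : measure_display) (T' : measurableType d')
  (P' : 'I_n -> probability T' R) (eta : nat -> T' -> 'I_n)
  (eta_chain : forall i : 'I_n,
     is_dtmc (P' i) eta (point_mass R i) (limit_jump_matrix Q))
  (eta_hits : forall i : 'I_n, fast_states Q i ->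
     P' i [set w | (discrete_hitting_time R eta (slow_states Q) w < +oo)%E]
     = 1%E)
  (pi : 'I_n -> R) (pi_distribution : is_distribution pi) :
  exists t : R -> R -> R,
    (forall l e : R, 0 < l -> 0 < e -> 0 < t l e) /\
    forall e : R, 0 < e ->
      (t l e @[l --> +oo] --> 0) /\
      \forall l \near +oo,
        forall (d : measure_display) (T : measurableType d)
          (P : probability T R) (X : R -> T -> 'I_n),
          is_ctmc P X pi (Q l) ->
          total_variation_distance (law_at P X (t l e))
            (law_at_first_passage P X (slow_states Q)) <= e.
Proof.
pose B := slow_states Q.
have hit i : ~ B i ->
    P' i [set w | (discrete_hitting_time R eta B w < +oo)%E] = 1%E.
  move=> Bi; apply: eta_hits; apply/eqP; rewrite -leye_eq leNgt.
  exact/negP.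
have [g [G [G0 gG gB gW]]] := hitting_potential eta_chain hit.
have [K K0 QK] := slow_exit_rate_bounded Q_rate Q_limit.
(* The summand 1/l keeps r positive when no state is fast. *)
pose r l := `|l|^-1 + \sum_(i | ~~ `[< B i >]) `|(exit_rate (Q l) i)^-1|.
have r_ge0 l : 0 <= r l by rewrite addr_ge0 ?invr_ge0// sumr_ge0.
have r_gt0 l : 0 < l -> 0 < r l.
  move=> l0; apply: (@lt_le_trans _ _ `|l|^-1); first by rewrite invr_gt0 normr_gt0 gt_eqF.
  by rewrite lerDl sumr_ge0.
have r_cvg : r l @[l --> +oo] --> 0.
  rewrite -[X in _ --> X]addr0; apply: cvgD.
    apply/gtr0_cvgV0; first by near=> l;
      rewrite normr_gt0 gt_eqF//; near: l; exact: nbhs_pinfty_gt.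
    apply/cvgryPge => A; near=> l; apply: le_trans (ler_norm l).
    by near: l; apply: nbhs_pinfty_ge; exact: num_real.
  rewrite [X in _ --> X](_ : 0 = \sum_(i | ~~ `[< B i >]) (0 : R)); last by rewrite big1.
  apply: cvg_sumr => i /asboolPn Bi.
  rewrite -[X in _ --> X](normr0 R); apply: cvg_norm; apply/gtr0_cvgV0.
    by have /cvgryPgt /(_ 0) := fast_exit_rate_cvg Q_rate Q_limit i Bi.
  exact: (fast_exit_rate_cvg Q_rate Q_limit i Bi).
(* The estimate is of order [r l / t l + t l]; the square root balances the two terms. *)
pose t l := Num.sqrt (r l).
have t_cvg : t l @[l --> +oo] --> 0.
  rewrite -[X in _ --> X](sqrtr0 R).
  by apply: (cvg_comp _ _ r_cvg); exact: sqrt_continuous.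
(* One time serves every [e], since the total error is at most a constant times [t l]. *)
exists (fun l _ => t l); split; first by move=> l e l0 _; rewrite sqrtr_gt0 r_gt0.
move=> e e0; split=> //.
(* Each of the [n] states contributes at most [(8 * G + K + 1) * t l]; the final 1 makes [C]
   positive whatever [n] is. *)
pose C := n%:R * (8 * G + K + 1) + 1.
have C0 : 0 < C by rewrite ltr_wpDl// mulr_ge0// !addr_ge0// mulr_ge0.
(* The limiting drift 1/2 is strictly larger than 1/4, so convergence of the jump matrix preserves
   1/4 for large [l]. *)
have jump_near i : ~ B i ->
    \forall l \near +oo, \sum_j jump_matrix (Q l) i j * g j < g i - 4^-1.
  move=> Bi.
  have : \sum_j jump_matrix (Q l) i j * g j @[l --> +oo] -->
         \sum_j limit_jump_matrix Q i j * g j.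
    apply: cvg_sumr => j _.
    by apply: cvgMl; apply: jump_matrix_cvg; exact: jump_limit.
  move/cvgr_lt; apply; apply: le_lt_trans (gW i Bi) _.
  by rewrite ltrD2l ltrN2 ltf_pV2 ?posrE// ltr_nat.
have fast_near : \forall l \near +oo, forall i, ~ B i ->
    0 < exit_rate (Q l) i /\ \sum_j jump_matrix (Q l) i j * g j < g i - 4^-1.
  apply: filter_forall => i; have [Bi|Bi] := pselect (B i); first by apply: nearW.
  have /cvgryPgt /(_ 0) q0 := fast_exit_rate_cvg Q_rate Q_limit i Bi.
  by near=> l => _; split; near: l; [exact: q0 | exact: jump_near].
near=> l => d T P X ctX.
have l0 : 0 < l by near: l; exact: nbhs_pinfty_gt.
have t0 : 0 < t l by rewrite sqrtr_gt0 r_gt0.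
have tr : r l = t l ^+ 2 by rewrite sqr_sqrtr.
have c0 : 0 < (4 * r l)^-1 by rewrite invr_gt0 mulr_gt0 ?r_gt0.
(* The inverse of a fast exit rate is a summand of [r l], so that rate is at least [(r l)^-1]; it
   multiplies the jump drift 1/4. *)
have Qg j : ~ B j -> \sum_k Q l j k * g k <= - (4 * r l)^-1.
  move=> Bj.
  have [q0 qg] : 0 < exit_rate (Q l) j /\
      \sum_k jump_matrix (Q l) j k * g k < g j - 4^-1.
    by move: j Bj; near: l; exact: fast_near.
  have rq : (exit_rate (Q l) j)^-1 <= r l.
    rewrite /r (bigD1 j)/=; last exact/asboolPn.
    have := ler_norm (exit_rate (Q l) j)^-1.
    have : 0 <= `|l|^-1 by rewrite invr_ge0.
    have : 0 <= \sum_(i | ~~ `[< B i >] && (i != j)) `|(exit_rate (Q l) i)^-1|.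
      exact: sumr_ge0.
    lra.
  have rq' : (r l)^-1 <= exit_rate (Q l) j.
    by rewrite -[leRHS]invrK lef_pV2 ?posrE ?invr_gt0 ?r_gt0.
  rewrite rate_jump_matrix// invfM.
  have : exit_rate (Q l) j * (\sum_k jump_matrix (Q l) j k * g k - g j) <=
         exit_rate (Q l) j * - 4^-1 by rewrite ler_wpM2l ?(ltW q0)//; lra.
  lra.
have QKl j : B j -> exit_rate (Q l) j <= K by move: j; near: l.
have bound i := ctmc_first_passage_estimate P X pi (Q l) B g (t l) (4 * r l)^-1 G K i
  ctX t0 c0 G0 K0 gG gB Qg QKl.
apply: (@le_trans _ _ (C * t l)); last first.
  rewrite mulrC -ler_pdivlMr//; apply: ltW; near: l.
  by apply: (cvgr_lt _ t_cvg); rewrite divr_gt0.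
rewrite /total_variation_distance.
apply: (@le_trans _ _ (\sum_(i < n) (8 * G + K + 1) * t l)); last first.
  by rewrite sumr_const card_ord /C [leRHS]mulrDl -mulrA [n%:R * _]mulr_natl mul1r lerDl ltW.
rewrite mulr_sumr; apply: ler_sum => i _.
apply: (@le_trans _ _ (1 * `|law_at P X (t l) i - law_at_first_passage P X B i|)).
  by rewrite ler_wpM2r//; lra.
rewrite mul1r; apply: le_trans (bound i) _; rewrite tr.
have -> : 2 * G / ((4 * t l ^+ 2)^-1 * t l) = 8 * G * t l.
  by field; rewrite gt_eqF.
lra.
Unshelve. all: end_near.
Qed.
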